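(* Let $(M,\boldsymbol{g})$ be an $n$-dimensional manifold ($n\ge 2$) with metric of arbitrary signature, and let $\boldsymbol{A}$ be a Killing-Yano tensor of order $p\ge 2$ on $M$. Then, writing $E=e_3e_4\cdots e_p$, the following two identities hold: $$\begin{aligned} 0={}& R^f{}_{acb}A_{dfE}+R^f{}_{bda}A_{cfE}+R^f{}_{cad}A_{bfE}+R^f{}_{dbc}A_{afE}\\ &+R^{\hat f}{}_{\hat e[bc}A_{d]a\hat F}+2\,R^{\hat f}{}_{\hat e a[b}A_{cd]\hat F}+2\,R^{\hat f}{}_{\hat e bc}A_{ad\hat F}-3\,R^{\hat f}{}_{\hat e[ab}A_{c]d\hat F}, \end{aligned}$$ $$0=2(n-p)\,R^f{}_{(c}A_{d)fE}+(n-2)\,C^{a\hat f}{}_{\hat e(c}A_{d)a\hat F}.$$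
   Context: $\nabla$ is the Levi-Civita connection of $\boldsymbol g$. Square (round) brackets denote normalized (weight one) antisymmetrization (symmetrization) over the enclosed free indices. A Killing-Yano tensor of order $p$ is a totally skew-symmetric tensor $\boldsymbol A$ of rank $p$ with $\nabla_aA_{b_1b_2\cdots b_p}+\nabla_{b_1}A_{ab_2\cdots b_p}=0$. The Riemann tensor is fixed by $(\nabla_a\nabla_b-\nabla_b\nabla_a)V_c=R_{abc}{}^{f}V_f$; the Ricci tensor is $R^a{}_b=R^{ca}{}_{cb}$; $C_{abcd}$ is the Weyl tensor, i.e. the totally trace-free part of $R_{abcd}$ (zero if $n=2$). Collective indices: $E=e_3e_4\cdots e_p$ is a block of $p-2$ indices, so $A_{cdE}=A_{cde_3\cdots e_p}$. When $\hat e$, $\hat f$, $\hat F$ occur, a sum over the position in the block is understood, with the index $e_i$ of $A$ replaced by the contracted index $f$; e.g. $$R^{\hat f}{}_{\hat e bc}\,A_{ad\hat F}=\sum_{i=3}^{p}R^{f}{}_{e_i bc}\,A_{ad e_3\cdots e_{i-1}fe_{i+1}\cdots e_p},$$ $$C^{a\hat f}{}_{\hat e c}\,A_{da\hat F}=\sum_{i=3}^{p}C^{af}{}_{e_i c}\,A_{da e_3\cdots e_{i-1}fe_{i+1}\cdots e_p}.$$ In terms such as $R^{\hat f}{}_{\hat e[bc}A_{d]a\hat F}$ the antisymmetrization involves only $b,c,d$ and not $\hat e$. For $p=2$ the block $E$ is empty and all terms containing $\hat e$ are absent. *)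

(* Defs.v *)
From HB Require Import structures.
From mathcomp Require Import all_boot all_order all_algebra all_fingroup.
From mathcomp Require Import all_classical all_reals all_analysis.

Set Implicit Arguments.
Unset Strict Implicit.
Unset Printing Implicit Defensive.

Import Order.TTheory GRing.Theory Num.Theory.
Import numFieldNormedType.Exports.
Local Open Scope classical_set_scope.
Local Open Scope ring_scope.

(** * Smooth manifolds, given by an atlas *)

Definition pderiv (R : realType) (n : nat) (a : 'I_n) (f : 'rV[R]_n -> R) :
    'rV[R]_n -> R :=
  fun u => 'D_(delta_mx 0 a) f u.

(* For an open set U; continuity of all iterated partial derivatives is what
   makes this C^k, their mere existence would not. *)
Fixpoint is_Ck (R : realType) (n k : nat) (U : set 'rV[R]_n)
    (f : 'rV[R]_n -> R) : Prop :=
  (forall u, U u -> {for u, continuous f}) /\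
  match k with
  | 0%N => True
  | k'.+1 => forall a : 'I_n,
      (forall u, U u -> derivable f u (delta_mx 0 a)) /\
      is_Ck k' U (pderiv a f)
  end.

Definition smooth_on (R : realType) (n : nat) (U : set 'rV[R]_n)
    (f : 'rV[R]_n -> R) : Prop :=
  forall k, is_Ck k U f.

(* [chart_map i] is the coordinate map of the chart [i], meaningful on the open
   set [chart_dom i] only, and [chart_inv i] is its inverse, meaningful on the
   open set [chart_map i @` chart_dom i] only. *)
Record manifold (R : realType) (n : nat) := Manifold {
  points :> topologicalType;
  points_hausdorff : hausdorff_space points;
  points_second_countable : @second_countable points;
  chart : Type;
  chart_dom : chart -> set points;
  chart_map : chart -> points -> 'rV[R]_n;
  chart_inv : chart -> 'rV[R]_n -> points;
  chart_dom_open : forall i, open (chart_dom i);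
  chart_cover : forall x, exists i, chart_dom i x;
  chart_img_open : forall i, open (chart_map i @` chart_dom i);
  chart_mapK : forall i x, chart_dom i x -> chart_inv i (chart_map i x) = x;
  chart_map_continuous : forall i x, chart_dom i x ->
    {for x, continuous (chart_map i)};
  chart_inv_continuous : forall i u, (chart_map i @` chart_dom i) u ->
    {for u, continuous (chart_inv i)};
  transition_smooth : forall i j (c : 'I_n),
    smooth_on (chart_map i @` (chart_dom i `&` chart_dom j))
      (fun u => chart_map j (chart_inv i u) 0 c)
}.

(** * Covariant tensors in one coordinate system *)

(* Components, as functions of the coordinates, of a covariant tensor of rank q:
   [T [tuple b_1; ..; b_q] u] is T_{b_1 ... b_q} at the point with coordinates
   u. *)
Definition components (R : realType) (n q : nat) : Type :=
  q.-tuple 'I_n -> 'rV[R]_n -> R.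

Definition set_index (n q : nat) (B : q.-tuple 'I_n) (k : 'I_q) (f : 'I_n) :
    q.-tuple 'I_n :=
  [tuple if j == k then f else tnth B j | j < q].

Definition gram (R : realType) (n : nat) (G : components R n 2)
    (u : 'rV[R]_n) : 'M[R]_n :=
  \matrix_(a, b) G [tuple a; b] u.

(* g^{ab} *)
Definition ginv (R : realType) (n : nat) (G : components R n 2)
    (u : 'rV[R]_n) (a b : 'I_n) : R :=
  invmx (gram G u) a b.

(* Gamma^f_{ab} *)
Definition christoffel (R : realType) (n : nat) (G : components R n 2)
    (f a b : 'I_n) (u : 'rV[R]_n) : R :=
  2^-1 * \sum_h ginv G u f h *
    (pderiv a (G [tuple b; h]) u + pderiv b (G [tuple a; h]) u
     - pderiv h (G [tuple a; b]) u).

(* The differentiation index is the first one of the result: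
   [nabla G T [tuple a; b_1; ..; b_q]] is nabla_a T_{b_1 ... b_q}. *)
Definition nabla (R : realType) (n q : nat) (G : components R n 2)
    (T : components R n q) : components R n q.+1 :=
  fun aB u =>
    let a := thead aB in
    let B := [tuple of behead aB] in
    pderiv a (T B) u
    - \sum_(k < q) \sum_f
        christoffel G f a (tnth B k) u * T (set_index B k f) u.

(* The coordinate covector field du^f, of constant components delta^f_c. *)
Definition dcoord (R : realType) (n : nat) (f : 'I_n) : components R n 1 :=
  fun B _ => (thead B == f)%:R.

(* R_{abc}^f, from (nabla_a nabla_b - nabla_b nabla_a) V_c = R_{abc}^f V_f read
   off on the covector field V = du^f (both sides are linear over functions
   in V, so that these values determine R_{abc}^f). *)
Definition riemann (R : realType) (n : nat) (G : components R n 2)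
    (u : 'rV[R]_n) (a b c f : 'I_n) : R :=
  nabla G (nabla G (dcoord f)) [tuple a; b; c] u
  - nabla G (nabla G (dcoord f)) [tuple b; a; c] u.

(* R_{abcd} *)
Definition riemann_low (R : realType) (n : nat) (G : components R n 2)
    (u : 'rV[R]_n) (a b c d : 'I_n) : R :=
  \sum_f riemann G u a b c f * G [tuple f; d] u.

(* R^f_{abc}, the first index being raised *)
Definition riemann_up (R : realType) (n : nat) (G : components R n 2)
    (u : 'rV[R]_n) (f a b c : 'I_n) : R :=
  \sum_h ginv G u f h * riemann_low G u h a b c.

(* R^a_b = R^{ca}_{cb} *)
Definition ricci_up (R : realType) (n : nat) (G : components R n 2)
    (u : 'rV[R]_n) (a b : 'I_n) : R :=
  \sum_c \sum_h \sum_k ginv G u c h * ginv G u a k * riemann_low G u h k c b.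

(* R_{ab} *)
Definition ricci_low (R : realType) (n : nat) (G : components R n 2)
    (u : 'rV[R]_n) (a b : 'I_n) : R :=
  \sum_h G [tuple a; h] u * ricci_up G u h b.

Definition scalar_curvature (R : realType) (n : nat) (G : components R n 2)
    (u : 'rV[R]_n) : R :=
  \sum_a ricci_up G u a a.

(* C_{abcd}, the totally trace-free part of R_{abcd}. The case n = 2 is separate
   because the denominators vanish there. *)
Definition weyl_low (R : realType) (n : nat) (G : components R n 2)
    (u : 'rV[R]_n) (a b c d : 'I_n) : R :=
  let g a b := G [tuple a; b] u in
  let Ric := ricci_low G u in
  if n == 2%N then 0 else
  riemann_low G u a b c d
  - (n%:R - 2)^-1 * (g a c * Ric b d - g a d * Ric b c
                     - g b c * Ric a d + g b d * Ric a c)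
  + scalar_curvature G u / ((n%:R - 1) * (n%:R - 2))
    * (g a c * g b d - g a d * g b c).

(* C^{af}_{ec}, the first two indices being raised *)
Definition weyl_up (R : realType) (n : nat) (G : components R n 2)
    (u : 'rV[R]_n) (a f e c : 'I_n) : R :=
  \sum_h \sum_k ginv G u a h * ginv G u f k * weyl_low G u h k e c.

(** * Tensor fields on a manifold *)

Definition jacobian (R : realType) (n : nat) (M : manifold R n)
    (i j : chart M) (b c : 'I_n) (u : 'rV[R]_n) : R :=
  pderiv b (fun v => chart_map j (chart_inv i v) 0 c) u.

Record tensor_field (R : realType) (n : nat) (M : manifold R n) (q : nat) :=
  TensorField {
  comp_in :> chart M -> components R n q;
  comp_smooth : forall i B,
    smooth_on (chart_map i @` chart_dom i) (comp_in i B);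
  comp_change : forall i j x, chart_dom i x -> chart_dom j x ->
    forall B : q.-tuple 'I_n,
    comp_in i B (chart_map i x) =
    \sum_(C : q.-tuple 'I_n)
      (\prod_(k < q) jacobian i j (tnth B k) (tnth C k) (chart_map i x))
      * comp_in j C (chart_map j x)
}.

Definition pseudo_riemannian (R : realType) (n : nat) (M : manifold R n)
    (g : tensor_field M 2) : Prop :=
  forall i x, chart_dom i x ->
    (forall a b,
      g i [tuple a; b] (chart_map i x) = g i [tuple b; a] (chart_map i x)) /\
    gram (g i) (chart_map i x) \in unitmx.

Definition skew_symmetric (R : realType) (n : nat) (M : manifold R n) (q : nat)
    (A : tensor_field M q) : Prop :=
  forall i x, chart_dom i x -> forall (B : q.-tuple 'I_n) (s : 'S_q),
    A i [tuple tnth B (s k) | k < q] (chart_map i x) =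
    (-1) ^+ odd_perm s * A i B (chart_map i x).

(* [k0] is the position of b_1 in B = b_1 ... b_q. *)
Definition killing_yano (R : realType) (n : nat) (M : manifold R n) (q : nat)
    (g : tensor_field M 2) (A : tensor_field M q) : Prop :=
  skew_symmetric A /\
  forall i x, chart_dom i x ->
  forall (a : 'I_n) (B : q.-tuple 'I_n) (k0 : 'I_q), k0 = 0%N :> nat ->
    nabla (g i) (A i) [tuple of a :: B] (chart_map i x)
    + nabla (g i) (A i) [tuple of tnth B k0 :: set_index B k0 a]
        (chart_map i x) = 0.

(** * Index conventions *)

(* The multi-index c d E of length p, E = e_3 ... e_p; for 2 <= p the default
   value of nth is never reached. *)
Definition join_index (n p : nat) (c d : 'I_n) (E : (p - 2).-tuple 'I_n) :
    p.-tuple 'I_n :=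
  [tuple nth c [:: c, d & E] k | k < p].

(* The hat convention: [X f e F] receives the summed index f, the index e_k it
   replaces, and the block F obtained from E by replacing e_k with f. *)
Definition hat_sum (R : realType) (n m : nat) (E : m.-tuple 'I_n)
    (X : 'I_n -> 'I_n -> m.-tuple 'I_n -> R) : R :=
  \sum_(k < m) \sum_f X f (tnth E k) (set_index E k f).

Definition sym2 (R : realType) (n : nat) (X : 'I_n -> 'I_n -> R)
    (a b : 'I_n) : R :=
  2^-1 * (X a b + X b a).

Definition alt3 (R : realType) (n : nat) (X : 'I_n -> 'I_n -> 'I_n -> R)
    (a b c : 'I_n) : R :=
  6^-1 * (X a b c - X a c b + X b c a - X b a c + X c a b - X c b a).

(* Main.v *)
Require Import Defs.
From HB Require Import structures.
From mathcomp Require Import all_boot all_order all_algebra all_fingroup.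
From mathcomp Require Import all_classical all_reals all_analysis.
From mathcomp Require Import ring lra.

Set Implicit Arguments.
Unset Strict Implicit.
Unset Printing Implicit Defensive.

Import Order.TTheory GRing.Theory Num.Theory.
Import numFieldNormedType.Exports.
Local Open Scope ring_scope.

(* Everything happens in one chart. The Killing-Yano equation makes the tensor
   X_{a|bcdE} = nabla_a nabla_b A_{cdE} skew in b, c, d. Its commutator in a, b
   is the curvature action S_{ab|cd} on A, so the six differences of the four
   components X_{a|bcd}, X_{b|acd}, X_{c|abd}, X_{d|abc} force
   T_{ab|cd} = S_{ab|cd} + S_{cd|ab} to satisfy T_{bc|ad} = T_{ab|cd} and
   T_{ab|cd} = - T_{ac|bd}. The first identity is
   2/3 T_{bc|ad} - 1/3 T_{ab|cd} + 1/3 T_{ac|bd} = 0, simplified by the Bianchi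
   identity. Contracting T_{ac|bd} with g^{ab} gives
   2 R^f_{(c} A_{d)fE} + R^{a f^}_{e^ (c} A_{d)a F^} = 0, and the second identity
   follows on splitting the Riemann tensor into its Weyl and Ricci parts; for
   n = 2 < p it holds because A vanishes. *)

(** * Symmetry of second derivatives *)

(** The difference quotients of the two derivatives coincide term by term. This brings directional
    derivatives within reach of the one-variable mean value theorem. *)
Lemma is_derive_line (R : realType) (V : normedModType R) (f : V -> R)
    (u v : V) (t : R) : derivable f (u + t *: v) v ->
  is_derive t 1 (fun s => f (u + s *: v)) ('D_v f (u + t *: v)).
Proof.
have E : (fun h : R => h^-1 *: ((f \o shift (u + t *: v)) (h *: v)
           - f (u + t *: v))) =
         (fun h : R => h^-1 *: (((fun s => f (u + s *: v)) \o shift t) (h *: 1)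
           - f (u + t *: v))).
  apply/funext => h; congr (_ *: (f _ - _)) => /=.
  by rewrite scalerDl [h *: 1]mulr1 addrCA.
move=> df; split; first by rewrite /derivable -E.
by rewrite /derive -E.
Qed.

(** Two applications of the mean value theorem: first along v to the increment of f in direction w,
    then along w to the resulting v-derivative. *)
Lemma second_difference_mvt (R : realType) (V : normedModType R) (f : V -> R)
    (u v w : V) (h : R) : 0 < h ->
  (forall s t, 0 <= s <= h -> 0 <= t <= h ->
     derivable f (u + t *: w + s *: v) v /\
     derivable ('D_v f) (u + s *: v + t *: w) w) ->
  exists s t, [/\ 0 <= s <= h, 0 <= t <= h &
    f (u + h *: w + h *: v) - f (u + h *: v) - f (u + h *: w) + f u =
    'D_w ('D_v f) (u + s *: v + t *: w) * h ^+ 2].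
Proof.
move=> h0 df.
have hb : 0 <= h <= h by rewrite lexx ltW.
have zb : 0 <= (0 : R) <= h by rewrite lexx ltW.
(* The term [0 *: w] keeps both summands in the form covered by [df], at t = h and at t = 0. *)
pose F s := f (u + h *: w + s *: v) - f (u + 0 *: w + s *: v).
pose dF s := 'D_v f (u + h *: w + s *: v) - 'D_v f (u + 0 *: w + s *: v).
have dFP (s : R) : 0 <= s <= h -> is_derive s 1 F (dF s).
  move=> sb; apply: is_deriveB; apply: is_derive_line.
    exact: (df _ _ sb hb).1.
  exact: (df _ _ sb zb).1.
have [s sb Fs] : exists2 s, s \in `]0, h[%R & F h - F 0 = dF s * (h - 0).
  apply: (@MVT R F dF 0 h h0).
    by move=> s /itvP sb; apply: dFP; rewrite !sb.
  apply: derivable_within_continuous => s sb.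
  have sb' : 0 <= s <= h by rewrite !(itvP sb).
  by case: (dFP _ sb').
have {}sb : 0 <= s <= h by rewrite !(itvP sb).
pose dK t := 'D_w ('D_v f) (u + s *: v + t *: w).
pose K t := 'D_v f (u + s *: v + t *: w).
have dKP (t : R) : 0 <= t <= h ->
    is_derive t 1 K (dK t).
  by move=> tb; apply: is_derive_line; exact: (df _ _ sb tb).2.
have [t tb Kt] : exists2 t, t \in `]0, h[%R &
    K h - K 0 = dK t * (h - 0).
  apply: (@MVT R K dK 0 h h0).
    by move=> t /itvP tb; apply: dKP; rewrite !tb.
  apply: derivable_within_continuous => t tb.
  have tb' : 0 <= t <= h by rewrite !(itvP tb).
  by case: (dKP _ tb').
have {}tb : 0 <= t <= h by rewrite !(itvP tb).
exists s, t; split=> //.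
move: Fs Kt; rewrite /F /dF /dK /K !scale0r !addr0 subr0.
rewrite (addrAC u (h *: w) (s *: v)) => Fs Kt.
rewrite expr2 mulrA -Kt -Fs; ring.
Qed.

Lemma eq_of_close_values (R : realType) (V : normedModType R) (F G : V -> R)
    (u : V) : {for u, continuous F} -> {for u, continuous G} ->
  (forall d, 0 < d -> exists y z, [/\ ball u d y, ball u d z & F y = G z]) ->
  F u = G u.
Proof.
move=> cF cG close.
apply/eqP; rewrite -subr_eq0 -normr_le0; apply/ler_addgt0Pr => e e0.
rewrite add0r.
have e20 : 0 < e / 2 by rewrite divr_gt0.
have /cvgrPdist_lt/(_ _ e20)/nbhs_ballP[d1 /= d10 b1] := cF.
have /cvgrPdist_lt/(_ _ e20)/nbhs_ballP[d2 /= d20 b2] := cG.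
have d0 : 0 < Num.min d1 d2 by rewrite lt_min d10.
have [y [z [yb zb E]]] := close _ d0.
have D1 : `|F u - F y| < e / 2.
  by apply: b1; apply: le_ball yb; rewrite ge_min lexx.
have D2 : `|G u - G z| < e / 2.
  by apply: b2; apply: le_ball zb; rewrite ge_min lexx orbT.
have -> : F u - G u = (F u - F y) + (G z - G u) by rewrite E addrA subrK.
rewrite (le_trans (ler_normD _ _))// [X in _ + X]distrC.
by move: D1 D2; move: `|_| `|_| => r1 r2; lra.
Qed.

(** The second difference of f at u is symmetric in v and w. Divided by h^2 it is a value of each
    mixed derivative near u, so the two agree at u by continuity. *)
Lemma derive_comm (R : realType) (V : normedModType R) (U : set V)
    (f : V -> R) (v w : V) : open U ->
  (forall u, U u -> derivable f u v) -> (forall u, U u -> derivable f u w) ->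
  (forall u, U u -> derivable ('D_v f) u w) ->
  (forall u, U u -> derivable ('D_w f) u v) ->
  (forall u, U u -> {for u, continuous ('D_w ('D_v f))}) ->
  (forall u, U u -> {for u, continuous ('D_v ('D_w f))}) ->
  forall u, U u -> 'D_w ('D_v f) u = 'D_v ('D_w f) u.
Proof.
move=> oU dv dw dvw dwv cvw cwv u Uu.
apply: (@eq_of_close_values R V _ _ u (cvw u Uu) (cwv u Uu)) => d1 d10.
have /nbhs_ballP[d2 /= d20 bU] : nbhs u U by exact: open_nbhs_nbhs.
pose d := Num.min d1 d2.
have d0 : 0 < d by rewrite lt_min d10.
pose N := `|v| + `|w| + 1.
have N0 : 0 < N by rewrite ltr_wpDl ?addr_ge0.
(* With this h every s v + t w with s, t in [0, h] has norm at most h N = d / 2 < d. The summand 1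
   in [N] keeps it positive when v = w = 0. *)
pose h := d / 2 / N.
have h0 : 0 < h by rewrite !divr_gt0.
have inb s t : 0 <= s <= h -> 0 <= t <= h -> ball u d (u + s *: v + t *: w).
  move=> /andP[s0 sh] /andP[t0 th].
  rewrite -ball_normE /= -addrA opprD addNKr normrN.
  apply: (le_lt_trans (ler_normD _ _)).
  rewrite !normrZ (ger0_norm s0) (ger0_norm t0).
  have : s * `|v| + t * `|w| <= h * N.
    rewrite /N !mulrDr mulr1.
    have : s * `|v| <= h * `|v| by rewrite ler_wpM2r.
    have : t * `|w| <= h * `|w| by rewrite ler_wpM2r.
    by move: h0; lra.
  by rewrite /h divfK ?gt_eqF//; move: d0; lra.
have inU s t : 0 <= s <= h -> 0 <= t <= h -> U (u + s *: v + t *: w).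
  by move=> sb tb; apply: bU; apply: le_ball (inb _ _ sb tb); rewrite ge_min lexx orbT.
have inb1 s t : 0 <= s <= h -> 0 <= t <= h -> ball u d1 (u + s *: v + t *: w).
  by move=> sb tb; apply: le_ball (inb _ _ sb tb); rewrite ge_min lexx.
have [s [t [sb tb E1]]] := @second_difference_mvt R V f u v w h h0
  (fun s t sb tb => conj
    (dv _ (eq_ind _ U (inU _ _ sb tb) _ (addrAC _ _ _)))
    (dvw _ (inU _ _ sb tb))).
have [s' [t' [sb' tb' E2]]] := @second_difference_mvt R V f u w v h h0
  (fun s t sb tb => conj
    (dw _ (inU _ _ tb sb))
    (dwv _ (eq_ind _ U (inU _ _ tb sb) _ (addrAC _ _ _)))).
exists (u + s *: v + t *: w), (u + s' *: w + t' *: v); split.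
- exact: inb1.
- by rewrite addrAC; exact: inb1.
- have h2 : h ^+ 2 != 0 by rewrite expf_neq0 ?gt_eqF.
  by apply: (mulIf h2); apply: etrans (esym E1) (etrans _ E2);
    rewrite (addrAC u (h *: v)); congr (_ + _); exact: addrAC.
Qed.

(** * Partial derivatives *)

Definition pderivable (R : realType) (n : nat) (f : 'rV[R]_n -> R)
    (u : 'rV[R]_n) : Prop :=
  forall a : 'I_n, derivable f u (delta_mx 0 a).

Section PartialDerivatives.
Context {R : realType} {n : nat}.
Implicit Types (f g : 'rV[R]_n -> R) (u : 'rV[R]_n) (a b : 'I_n).

Lemma pderivable_cst (c : R) u : pderivable (fun=> c) u.
Proof. by move=> a; exact: derivable_cst. Qed.

Lemma pderivableD f g u : pderivable f u -> pderivable g u ->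
  pderivable (fun z => f z + g z) u.
Proof. by move=> df dg a; exact: (derivableD (df a) (dg a)). Qed.

Lemma pderivableN f u : pderivable f u -> pderivable (fun z => - f z) u.
Proof. by move=> df a; exact: (derivableN (df a)). Qed.

Lemma pderivableM f g u : pderivable f u -> pderivable g u ->
  pderivable (fun z => f z * g z) u.
Proof. by move=> df dg a; exact: (derivableM (df a) (dg a)). Qed.

Lemma pderivableV f u : f u != 0 -> pderivable f u ->
  pderivable (fun z => (f z)^-1) u.
Proof. by move=> f0 df a; exact: (derivableV f0 (df a)). Qed.

Lemma pderivable_sum (I : Type) (r : seq I) (P : pred I) F u :
  (forall i, pderivable (F i) u) ->
  pderivable (fun z => \sum_(i <- r | P i) F i z) u.
Proof.
move=> dF; elim: r => [|i r IH].
  under eq_fun do rewrite big_nil; exact: pderivable_cst.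
under eq_fun do rewrite big_cons.
case: (P i); [exact: (pderivableD (dF i) IH) | exact: IH].
Qed.

Lemma pderivable_prod (I : Type) (r : seq I) (P : pred I) F u :
  (forall i, pderivable (F i) u) ->
  pderivable (fun z => \prod_(i <- r | P i) F i z) u.
Proof.
move=> dF; elim: r => [|i r IH].
  under eq_fun do rewrite big_nil; exact: pderivable_cst.
under eq_fun do rewrite big_cons.
case: (P i); [exact: (pderivableM (dF i) IH) | exact: IH].
Qed.

Lemma pderiv_cst (c : R) a u : pderiv a (fun=> c) u = 0.
Proof. exact: derive_cst. Qed.

Lemma pderivD f g a u : pderivable f u -> pderivable g u ->
  pderiv a (fun z => f z + g z) u = pderiv a f u + pderiv a g u.
Proof. by move=> df dg; exact: (deriveD (df a) (dg a)). Qed.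

Lemma pderivN f a u : pderivable f u ->
  pderiv a (fun z => - f z) u = - pderiv a f u.
Proof. by move=> df; exact: (deriveN (df a)). Qed.

Lemma pderivM f g a u : pderivable f u -> pderivable g u ->
  pderiv a (fun z => f z * g z) u = pderiv a f u * g u + f u * pderiv a g u.
Proof.
move=> df dg; rewrite /pderiv (deriveM (df a) (dg a)) addrC.
by congr (_ + _); rewrite /GRing.scale /= mulrC.
Qed.

Lemma pderiv_sum (I : Type) (r : seq I) (P : pred I) F a u :
  (forall i, pderivable (F i) u) ->
  pderiv a (fun z => \sum_(i <- r | P i) F i z) u =
  \sum_(i <- r | P i) pderiv a (F i) u.
Proof.
move=> dF; elim: r => [|i r IH].
  by rewrite big_nil; under eq_fun do rewrite big_nil; exact: pderiv_cst.
rewrite big_cons -IH; under eq_fun do rewrite big_cons.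
by case: (P i) => //; apply: pderivD => //; exact: pderivable_sum.
Qed.

Lemma eq_near_pderivable f g u : (\forall z \near u, f z = g z) ->
  pderivable f u -> pderivable g u.
Proof. by move=> fg df a; exact: (near_eq_derivable fg (df a)). Qed.

Lemma eq_near_pderiv f g a u : (\forall z \near u, f z = g z) ->
  pderiv a f u = pderiv a g u.
Proof. by move=> fg; exact: near_eq_derive. Qed.

Lemma pderivable_det m (M : 'rV[R]_n -> 'M[R]_m) u :
  (forall i j, pderivable (fun z => M z i j) u) ->
  pderivable (fun z => \det (M z)) u.
Proof.
move=> dM; rewrite /determinant; apply: pderivable_sum => s.
apply: pderivableM; first exact: pderivable_cst.
by apply: pderivable_prod.
Qed.

(** Cramer's rule writes the inverse with determinants. It describes [invmx] at invertible matrices,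
    hence invertibility is assumed near u. *)
Lemma pderivable_invmx m (M : 'rV[R]_n -> 'M[R]_m) u i j :
  (forall i j, pderivable (fun z => M z i j) u) ->
  (\forall z \near u, M z \in unitmx) ->
  pderivable (fun z => invmx (M z) i j) u.
Proof.
move=> dM uM.
have E : \forall z \near u,
    (\det (M z))^-1 * ((-1) ^+ (j + i) * \det (row' j (col' i (M z)))) =
    invmx (M z) i j.
  by apply: filterS uM => z uMz; rewrite /invmx uMz mxE [\adj _ _ _]mxE.
apply: (eq_near_pderivable E); apply: pderivableM.
  apply: pderivableV; last exact: pderivable_det.
  by have := nbhs_singleton uM; rewrite unitmxE unitfE.
apply: pderivableM; first exact: pderivable_cst.
apply: pderivable_det => k l.
by under eq_fun do rewrite !mxE; exact: dM.
Qed.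

Section OpenSet.
Context {U : set 'rV[R]_n} (oU : open U).

Lemma smooth_on_pderiv f a : smooth_on U f -> smooth_on U (pderiv a f).
Proof. by move=> sf k; have [_ /(_ a)[]] := sf k.+1. Qed.

Lemma smooth_on_pderivable f u : smooth_on U f -> U u -> pderivable f u.
Proof. by move=> sf Uu a; have [_ /(_ a)[+ _]] := sf 1; apply. Qed.

Lemma smooth_on_continuous f u : smooth_on U f -> U u ->
  {for u, continuous f}.
Proof. by move=> sf; have [+ _] := sf 0; apply. Qed.

Lemma pderiv_comm f a b u : smooth_on U f -> U u ->
  pderiv a (pderiv b f) u = pderiv b (pderiv a f) u.
Proof.
move=> sf; apply: (@derive_comm R _ U f (delta_mx 0 b) (delta_mx 0 a) oU).
- by move=> z Uz; exact: (smooth_on_pderivable sf Uz).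
- by move=> z Uz; exact: (smooth_on_pderivable sf Uz).
- move=> z Uz; exact: (smooth_on_pderivable (smooth_on_pderiv b sf) Uz).
- move=> z Uz; exact: (smooth_on_pderivable (smooth_on_pderiv a sf) Uz).
- move=> z Uz; apply: (smooth_on_continuous _ Uz).
  exact: (smooth_on_pderiv a (smooth_on_pderiv b sf)).
- move=> z Uz; apply: (smooth_on_continuous _ Uz).
  exact: (smooth_on_pderiv b (smooth_on_pderiv a sf)).
Qed.

Lemma near_open u (P : 'rV[R]_n -> Prop) : U u -> (forall z, U z -> P z) ->
  \forall z \near u, P z.
Proof.
move=> Uu UP; apply: (@filterS _ (nbhs u) _ U _ UP).
exact: open_nbhs_nbhs.
Qed.

End OpenSet.
End PartialDerivatives.

(** * The Levi-Civita connection in a chart *)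

Definition perm_index (n q : nat) (s : 'S_q) (B : q.-tuple 'I_n) :
    q.-tuple 'I_n :=
  [tuple tnth B (s k) | k < q].

Section Indices.
Context {n q : nat}.
Implicit Types (B : q.-tuple 'I_n) (a f h : 'I_n).

Lemma tnth_set_index B k f j :
  tnth (set_index B k f) j = if j == k then f else tnth B j.
Proof. by rewrite tnth_mktuple. Qed.

Lemma tnth_perm_index (s : 'S_q) B j : tnth (perm_index s B) j = tnth B (s j).
Proof. by rewrite tnth_mktuple. Qed.

End Indices.

Section IndexSurgery.
Context {n q : nat}.
Implicit Types (B : q.-tuple 'I_n) (a f h : 'I_n).

Lemma set_index_id B k f h :
  set_index (set_index B k f) k h = set_index B k h.
Proof.
by apply: eq_from_tnth => j; rewrite !tnth_set_index; case: eqVneq.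
Qed.

Lemma set_indexC B k l f h : k != l ->
  set_index (set_index B k f) l h = set_index (set_index B l h) k f.
Proof.
move=> kl; apply: eq_from_tnth => j; rewrite !tnth_set_index.
by case: (eqVneq j l) => // ->; rewrite eq_sym (negPf kl).
Qed.

Lemma set_perm_index (s : 'S_q) B k f :
  set_index (perm_index s B) k f = perm_index s (set_index B (s k) f).
Proof.
apply: eq_from_tnth => j.
by rewrite !(tnth_set_index, tnth_perm_index) (inj_eq perm_inj).
Qed.

Lemma behead_cons a B : [tuple of behead [tuple of a :: B]] = B.
Proof. exact: val_inj. Qed.

Lemma set_index_cons0 a B f :
  set_index [tuple of a :: B] ord0 f = [tuple of f :: B].
Proof.
apply: eq_from_tnth => j; rewrite tnth_set_index.
by case: (unliftP ord0 j) => [k ->|->] //=; rewrite !tnthS.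
Qed.

Lemma set_index_consS a B k f :
  set_index [tuple of a :: B] (lift ord0 k) f = [tuple of a :: set_index B k f].
Proof.
apply: eq_from_tnth => j; rewrite tnth_set_index.
case: (unliftP ord0 j) => [l ->|->] //=.
by rewrite !tnthS tnth_set_index (inj_eq lift_inj).
Qed.

(** [lift_perm ord0 ord0 s] fixes the derivative slot, so that a symmetry of a tensor can be read as
    one of its covariant derivative. *)
Lemma perm_index_cons (s : 'S_q) a B :
  perm_index (lift_perm ord0 ord0 s) [tuple of a :: B] =
  [tuple of a :: perm_index s B].
Proof.
apply: eq_from_tnth => j; rewrite tnth_perm_index.
case: (unliftP ord0 j) => [l ->|->].
  by rewrite lift_perm_lift !tnthS tnth_perm_index.
by rewrite lift_perm_id.
Qed.

End IndexSurgery.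

Section LeviCivita.
Context {R : realType} {n : nat} {U : set 'rV[R]_n} (oU : open U).
Context {G : components R n 2} (sG : forall B, smooth_on U (G B)).
Context (symG : forall u, U u ->
  forall a b, G [tuple a; b] u = G [tuple b; a] u).
Context (unitG : forall u, U u -> gram G u \in unitmx).
Implicit Types (a b c d f h : 'I_n) (u : 'rV[R]_n).
Local Notation Gam := (christoffel G).

Lemma christoffel_sym f a b u : U u -> Gam f a b u = Gam f b a u.
Proof.
move=> Uu; congr (_ * _); apply: eq_bigr => h _; congr (_ * _).
rewrite [pderiv h _ u](eq_near_pderiv (g := G [tuple b; a])); last first.
  by apply: (near_open oU Uu) => z Uz; exact: symG.
by congr (_ - _); rewrite addrC.
Qed.

Lemma ginv_sym a b u : U u -> ginv G u a b = ginv G u b a.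
Proof.
move=> Uu; have gT : (gram G u)^T = gram G u.
  by apply/matrixP => i j; rewrite !mxE symG.
by rewrite /ginv -[in LHS]gT -trmx_inv mxE.
Qed.

Lemma ginvK a b u : U u ->
  \sum_h ginv G u a h * G [tuple h; b] u = (a == b)%:R.
Proof.
move=> Uu; have := mulVmx (unitG Uu) => /matrixP/(_ a b).
by rewrite !mxE => <-; apply: eq_bigr => h _; rewrite mxE.
Qed.

Lemma pderivable_christoffel f a b u : U u -> pderivable (Gam f a b) u.
Proof.
move=> Uu; apply: pderivableM; first exact: pderivable_cst.
apply: pderivable_sum => h; apply: pderivableM.
  apply: pderivable_invmx; last exact: (near_open oU Uu).
  move=> i j; under eq_fun do rewrite mxE.
  exact: (smooth_on_pderivable (sG _) Uu).
have d c B : pderivable (pderiv c (G B)) u.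
  exact: (smooth_on_pderivable (smooth_on_pderiv c (sG _)) Uu).
apply: pderivableD (pderivableN (d _ _)).
exact: pderivableD.
Qed.

Lemma nabla_cons q (T : components R n q) a (B : q.-tuple 'I_n) u :
  nabla G T [tuple of a :: B] u =
  pderiv a (T B) u
  - \sum_(k < q) \sum_f Gam f a (tnth B k) u * T (set_index B k f) u.
Proof. by rewrite /nabla theadE behead_cons. Qed.

Lemma tuple1_cons a : [tuple a] = [tuple of a :: [tuple]] :> 1.-tuple 'I_n.
Proof. exact: val_inj. Qed.

Lemma tuple2_cons a b : [tuple a; b] = [tuple of a :: [tuple b]].
Proof. exact: val_inj. Qed.

Lemma tuple3_cons a b c : [tuple a; b; c] = [tuple of a :: [tuple b; c]].
Proof. exact: val_inj. Qed.

(** * Curvature in coordinates and the Ricci identity *)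

Lemma nabla_dcoord f b c :
  nabla G (dcoord f) [tuple b; c] = fun u => - Gam f b c u.
Proof.
apply/funext => u.
rewrite tuple2_cons nabla_cons /dcoord pderiv_cst sub0r big_ord1 (bigD1 f) //=.
rewrite big1 => [|h hf].
  by rewrite tuple1_cons set_index_cons0 theadE eqxx mulr1 addr0.
by rewrite tuple1_cons set_index_cons0 theadE (negPf hf) mulr0.
Qed.

(** Differentiating the components -Gamma^f_{bc} of nabla du^f once more gives three terms; the one
    containing Gamma^h_{ab} leaves the commutator because Gamma is symmetric below. *)
Lemma riemannE a b c f u : U u ->
  riemann G u a b c f =
  pderiv b (Gam f a c) u - pderiv a (Gam f b c) u
  + \sum_h (Gam h a c u * Gam f b h u - Gam h b c u * Gam f a h u).
Proof.
move=> Uu.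
have E a' b' : nabla G (nabla G (dcoord f)) [tuple a'; b'; c] u =
    - pderiv a' (Gam f b' c) u + \sum_h Gam h a' b' u * Gam f h c u
    + \sum_h Gam h a' c u * Gam f b' h u.
  rewrite tuple3_cons nabla_cons.
  rewrite nabla_dcoord pderivN; last exact: pderivable_christoffel.
  rewrite big_ord_recl big_ord1 opprD addrA.
  congr (_ + _ + _); rewrite -sumrN; apply: eq_bigr => h _.
    rewrite tuple2_cons set_index_cons0 -tuple2_cons nabla_dcoord.
    by rewrite mulrN opprK.
  rewrite tuple2_cons set_index_consS tuple1_cons set_index_cons0.
  by rewrite -tuple1_cons -tuple2_cons nabla_dcoord mulrN opprK.
rewrite /riemann !E sumrB.
rewrite (eq_bigr (fun h => Gam h b a u * Gam f h c u)); last first.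
  by move=> h _; rewrite (christoffel_sym _ a b Uu).
do 2![move: (pderiv _ _ _) => ?]; do 3![move: (\sum_(h < n) _) => ?]; ring.
Qed.

Lemma riemann_antisym a b c f u : riemann G u b a c f = - riemann G u a b c f.
Proof. exact: (esym (opprB _ _)). Qed.

(** By the symmetry of Gamma in its lower indices, both the derivative terms [D] and the quadratic
    terms [S] cancel in pairs in the cyclic sum. *)
Lemma riemann_cyclic a b c f u : U u ->
  riemann G u a b c f + riemann G u b c a f + riemann G u c a b f = 0.
Proof.
move=> Uu.
pose D a b c := pderiv a (Gam f b c) u.
pose S a b c := \sum_h Gam h a b u * Gam f c h u.
have DE d b' c' : D d b' c' = D d c' b'.
  apply: eq_near_pderiv; apply: (near_open oU Uu) => z Uz.
  exact: christoffel_sym.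
have SE b' c' d : S b' c' d = S c' b' d.
  by apply: eq_bigr => h _; rewrite (christoffel_sym h b' c' Uu).
have RE a' b' c' : riemann G u a' b' c' f =
    D b' a' c' - D a' b' c' + (S a' c' b' - S b' c' a').
  by rewrite riemannE // sumrB.
rewrite !RE (DE b a c) (DE a b c) (DE c b a) (SE a c) (SE b c) (SE b a).
move: (D b c a) (D a c b) (D c a b) (S c a b) (S c b a) (S a b c) =>
  x1 x2 x3 x4 x5 x6; ring.
Qed.

Lemma nabla_pderivable q (T : components R n q) C u :
  (forall B, smooth_on U (T B)) -> U u -> pderivable (nabla G T C) u.
Proof.
move=> sT Uu; rewrite /nabla.
apply: pderivableD.
  exact: (smooth_on_pderivable (smooth_on_pderiv _ (sT _)) Uu).
apply: pderivableN; apply: pderivable_sum => k; apply: pderivable_sum => f.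
apply: pderivableM; first exact: pderivable_christoffel.
exact: (smooth_on_pderivable (sT _) Uu).
Qed.

(* Pairs of distinct positions cancel against the same pair with the roles of
   the two derivatives exchanged. *)
Lemma christoffel_square_commutator q (T : components R n q) a b (B : q.-tuple 'I_n) u :
  let Q a b := \sum_(k < q) \sum_f Gam f a (tnth B k) u *
    \sum_(l < q) \sum_h Gam h b (tnth (set_index B k f) l) u *
      T (set_index (set_index B k f) l h) u in
  Q a b - Q b a =
  \sum_(k < q) \sum_h (\sum_f (Gam f a (tnth B k) u * Gam h b f u
     - Gam f b (tnth B k) u * Gam h a f u)) * T (set_index B k h) u.
Proof.
move=> Q.
pose Od a b := \sum_(k < q) \sum_(l < q | l != k) \sum_f \sum_h
  Gam f a (tnth B k) u * Gam h b (tnth B l) u *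
  T (set_index (set_index B k f) l h) u.
pose Dg a b := \sum_(k < q) \sum_h (\sum_f
  Gam f a (tnth B k) u * Gam h b f u) * T (set_index B k h) u.
have QE a' b' : Q a' b' = Dg a' b' + Od a' b'.
  rewrite -big_split; apply: eq_bigr => k _ /=.
  transitivity (\sum_f (\sum_h
      Gam f a' (tnth B k) u * Gam h b' f u * T (set_index B k h) u
    + \sum_(l < q | l != k) \sum_h Gam f a' (tnth B k) u *
        Gam h b' (tnth B l) u * T (set_index (set_index B k f) l h) u)).
    apply: eq_bigr => f _; rewrite (bigD1 k) //= mulrDr !mulr_sumr.
    congr (_ + _).
      by apply: eq_bigr => h _; rewrite tnth_set_index eqxx set_index_id mulrA.
    apply: eq_bigr => l lk; rewrite mulr_sumr; apply: eq_bigr => h _.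
    by rewrite tnth_set_index (negPf lk) mulrA.
  rewrite big_split /=; congr (_ + _); last exact: exchange_big.
  by rewrite exchange_big; apply: eq_bigr => h _; rewrite mulr_suml.
have OE : Od b a = Od a b.
  rewrite /Od (exchange_big_dep xpredT) //=; apply: eq_bigr => l _.
  apply: eq_big => [k|k kl]; first by rewrite eq_sym.
  rewrite exchange_big; apply: eq_bigr => h _; apply: eq_bigr => f _.
  by rewrite set_indexC 1?eq_sym// [Gam f b _ _ * _]mulrC.
rewrite !QE OE opprD addrACA subrr addr0 -sumrB; apply: eq_bigr => k _.
rewrite -sumrB; apply: eq_bigr => h _.
by rewrite -mulrBl -sumrB.
Qed.

(** The Ricci identity. Second partial derivatives commute, the term Gamma^f_{ab} nabla_f T is
    symmetric in a and b, and what survives is the coordinate formula [riemannE] in each slot. *)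
Lemma nabla_commutator q (T : components R n q) a b (B : q.-tuple 'I_n) u :
  (forall B, smooth_on U (T B)) -> U u ->
  nabla G (nabla G T) [tuple of a :: [tuple of b :: B]] u
  - nabla G (nabla G T) [tuple of b :: [tuple of a :: B]] u =
  \sum_(k < q) \sum_f riemann G u a b (tnth B k) f * T (set_index B k f) u.
Proof.
move=> sT Uu.
(* In the second derivative, [Q] collects the products of two Christoffel symbols, [P] the
   derivatives of a Christoffel symbol, and [W] the products of one with a derivative of T. [W]
   enters symmetrized in a and b and cancels. *)
pose Q a b := \sum_(k < q) \sum_f Gam f a (tnth B k) u *
    \sum_(l < q) \sum_h Gam h b (tnth (set_index B k f) l) u *
      T (set_index (set_index B k f) l h) u.
pose P a b := \sum_(k < q) \sum_f
  pderiv a (Gam f b (tnth B k)) u * T (set_index B k f) u.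
pose W a b := \sum_(k < q) \sum_f
  Gam f b (tnth B k) u * pderiv a (T (set_index B k f)) u.
have dT B' : pderivable (T B') u by exact: (smooth_on_pderivable (sT _) Uu).
have dG f a' b' : pderivable (Gam f a' b') u by exact: pderivable_christoffel.
have E a' b' : nabla G (nabla G T) [tuple of a' :: [tuple of b' :: B]] u =
    pderiv a' (pderiv b' (T B)) u - P a' b' - W a' b'
    - \sum_f Gam f a' b' u * nabla G T [tuple of f :: B] u
    - W b' a' + Q a' b'.
  rewrite nabla_cons.
  rewrite (_ : nabla G T [tuple of b' :: B] = fun z =>
      pderiv b' (T B) z
      + - \sum_(k < q) \sum_f Gam f b' (tnth B k) z * T (set_index B k f) z);
    last by apply/funext => z; rewrite nabla_cons.
  have dd : pderivable (fun z => \sum_(k < q) \sum_f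
      Gam f b' (tnth B k) z * T (set_index B k f) z) u.
    by apply: pderivable_sum => k; apply: pderivable_sum => f;
      exact: (pderivableM (dG _ _ _) (dT _)).
  rewrite pderivD; last exact: pderivableN.
    rewrite pderivN // pderiv_sum; last first.
      by move=> k; apply: pderivable_sum => f;
      exact: (pderivableM (dG _ _ _) (dT _)).
    under eq_bigr => k _.
      rewrite pderiv_sum; last by move=> f; exact: (pderivableM (dG _ _ _) (dT _)).
      under eq_bigr => f _ do rewrite (pderivM _ (dG _ _ _) (dT _)).
      rewrite big_split /=; over.
    rewrite big_split /= -/(P a' b') -/(W a' b').
    rewrite big_ord_recl /=.
    under eq_bigr => f _ do rewrite set_index_cons0.
    under [X in _ - (_ + X)]eq_bigr => k _ do
      under eq_bigr => f _ do rewrite tnthS set_index_consS nabla_cons mulrBr.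
    under [X in _ - (_ + X)]eq_bigr => k _ do rewrite sumrB.
    rewrite sumrB -/(W b' a') -/(Q a' b').
    rewrite (_ : tnth [tuple of b' :: B] ord0 = b') //.
    move: (pderiv _ _ _) (P _ _) (W _ _) (W _ _) (Q _ _) (\sum_f _) =>
      d1 p1 w1 w2 q1 s1.
    ring.
  exact: (smooth_on_pderivable (smooth_on_pderiv _ (sT _)) Uu).
rewrite !E (pderiv_comm oU a b (sT _) Uu).
under [X in _ - X - _ + _ - _]eq_bigr => f _ do
  rewrite (christoffel_sym f a b Uu).
have := christoffel_square_commutator T a b B u.
rewrite -/(Q a b) -/(Q b a) => QE.
transitivity (P b a - P a b + (Q a b - Q b a)).
  move: (pderiv _ _ _) (P a b) (P b a) (W a b) (W b a) (Q a b) (Q b a)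
    (\sum_f _) => d1 p1 p2 w1 w2 q1 q2 s1.
  ring.
rewrite QE -sumrB -big_split; apply: eq_bigr => k _ /=.
rewrite -sumrB -big_split; apply: eq_bigr => f _ /=.
by rewrite -mulrBl -mulrDl riemannE.
Qed.

(** * Metric compatibility and the symmetries of the Riemann tensor *)

Lemma nabla_metric C u : U u -> nabla G G C u = 0.
Proof.
(* [lowGam] is Gamma with its upper index lowered; nabla_a g_{bc} vanishes because [lowGam c a b]
   and [lowGam b a c] add up to the partial derivative of g_{bc}. *)
move=> Uu; pose lowGam c a b := 2^-1 * (pderiv a (G [tuple b; c]) u
  + pderiv b (G [tuple a; c]) u - pderiv c (G [tuple a; b]) u).
have lowE c a b : \sum_f Gam f a b u * G [tuple f; c] u = lowGam c a b.
  rewrite /christoffel.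
  under eq_bigr => f _ do rewrite -mulrA mulr_suml.
  rewrite -mulr_sumr exchange_big /=; congr (_ * _).
  rewrite (bigD1 c) //= [X in _ + X]big1 => [|h hc].
    under eq_bigr => f _ do rewrite mulrAC (ginv_sym _ _ Uu).
    by rewrite -mulr_suml ginvK // eqxx mul1r addr0.
  under eq_bigr => f _ do rewrite mulrAC (ginv_sym _ _ Uu).
  by rewrite -mulr_suml ginvK // (negPf hc) mul0r.
have [a [b [c ->]]] : exists a b c, C = [tuple a; b; c].
  exists (tnth C ord0), (tnth C (lift ord0 ord0)),
    (tnth C (lift ord0 (lift ord0 ord0))).
  apply: eq_from_tnth => k; case: (unliftP ord0 k) => [k1 ->|->] //.
  case: (unliftP ord0 k1) => [k2 ->|->] //.
  by case: (unliftP ord0 k2) => [[]|->].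
rewrite tuple3_cons nabla_cons big_ord_recl big_ord1.
rewrite (eq_bigr (fun f => Gam f a b u * G [tuple f; c] u)); last first.
  by move=> f _; rewrite tuple2_cons set_index_cons0.
rewrite [X in _ - (_ + X)](eq_bigr (fun f => Gam f a c u * G [tuple f; b] u)); last first.
  move=> f _; rewrite tuple2_cons set_index_consS tuple1_cons set_index_cons0.
  by rewrite -tuple1_cons -tuple2_cons symG.
have sd d a' b' : pderiv d (G [tuple a'; b']) u = pderiv d (G [tuple b'; a']) u.
  by apply: eq_near_pderiv; apply: (near_open oU Uu) => z Uz; exact: symG.
rewrite !lowE /lowGam (sd a c b).
do 3![move: (pderiv _ _ _) => ?]; by field.
Qed.

(** The Ricci identity is applied to the metric itself, whose second covariant derivatives vanish.
    The two slots yield R_{abcd} and R_{abdc}. *)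
Lemma riemann_low_antisym_r a b c d u : U u ->
  riemann_low G u a b d c = - riemann_low G u a b c d.
Proof.
move=> Uu; apply/eqP; rewrite -addr_eq0 addrC; apply/eqP.
have N a' (b' : 3.-tuple 'I_n) : nabla G (nabla G G) [tuple of a' :: b'] u = 0.
  rewrite nabla_cons (eq_near_pderiv (g := fun=> 0)); last first.
    by apply: (near_open oU Uu) => z Uz; rewrite nabla_metric.
  rewrite pderiv_cst sub0r big1 ?oppr0 // => k _; rewrite big1 // => f _.
  by rewrite nabla_metric // mulr0.
have := nabla_commutator a b [tuple c; d] sG Uu.
rewrite !N subrr big_ord_recl big_ord1 => ->; congr (_ + _).
  by apply: eq_bigr => f _; rewrite tuple2_cons set_index_cons0.
apply: eq_bigr => f _.
rewrite tuple2_cons set_index_consS tuple1_cons set_index_cons0.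
by rewrite -tuple1_cons -tuple2_cons symG.
Qed.

Lemma riemann_low_antisym_l a b c d u :
  riemann_low G u b a c d = - riemann_low G u a b c d.
Proof.
by rewrite -sumrN; apply: eq_bigr => f _; rewrite riemann_antisym mulNr.
Qed.

Lemma riemann_low_cyclic a b c d u : U u ->
  riemann_low G u a b c d + riemann_low G u b c a d + riemann_low G u c a b d
  = 0.
Proof.
move=> Uu; rewrite -!big_split big1 //= => f _.
by rewrite -!mulrDl riemann_cyclic // mul0r.
Qed.

(** The four cyclic identities, one for each choice of last index, become linear relations between
    six components once the skew symmetries are used; they force the exchange of pairs. *)
Lemma riemann_low_pair_sym a b c d u : U u ->
  riemann_low G u c d a b = riemann_low G u a b c d.
Proof.
move=> Uu; set r := riemann_low G u.
have aL a' b' c' d' : r b' a' c' d' = - r a' b' c' d'.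
  exact: riemann_low_antisym_l.
have aR a' b' c' d' : r a' b' d' c' = - r a' b' c' d'.
  exact: riemann_low_antisym_r.
have cyc a' b' c' d' : r a' b' c' d' + r b' c' a' d' + r c' a' b' d' = 0.
  exact: riemann_low_cyclic.
have C1 : r a b c d + r b c a d - r a c b d = 0.
  by rewrite -(cyc a b c d) (aL a c b d).
have C2 : - r b c a d - r c d a b + r b d a c = 0.
  by rewrite -(cyc b c d a) (aR b c a d) (aL b d c a) (aR c d a b) (aR b d a c) opprK.
have C3 : r c d a b + r a d b c - r a c b d = 0.
  by rewrite -(cyc c d a b) (aL a d c b) (aR a d b c) opprK (aR a c b d).
have C4 : - r a d b c - r a b c d + r b d a c = 0.
  by rewrite -(cyc d a b c) (aL a d b c) (aR a b c d).
move: C1 C2 C3 C4; move: (r a b c d) (r b c a d) (r a c b d) (r c d a b)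
  (r b d a c) (r a d b c) => x1 x2 x3 x4 x5 x6.
lra.
Qed.

(** Reindexing the sum over slots by s carries the symmetry through the connection terms. It is
    required on all of U because it gets differentiated; T may itself be a covariant derivative, and
    s may move its derivative slot. *)
Lemma nabla_perm q (T : components R n q) (s : 'S_q) (e : R) :
  (forall B u, U u -> pderivable (T B) u) ->
  (forall B u, U u -> T (perm_index s B) u = e * T B u) ->
  forall a (B : q.-tuple 'I_n) u, U u ->
  nabla G T [tuple of a :: perm_index s B] u = e * nabla G T [tuple of a :: B] u.
Proof.
move=> dT Ts a B u Uu; rewrite !nabla_cons mulrBr; congr (_ - _).
  rewrite (eq_near_pderiv (g := fun z => e * T B z)); last first.
    by apply: (near_open oU Uu) => z; exact: Ts.
  rewrite pderivM; [|exact: pderivable_cst|exact: dT].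
  by rewrite pderiv_cst mul0r add0r.
rewrite mulr_sumr [RHS](reindex_inj (@perm_inj _ s)); apply: eq_bigr => k _.
rewrite mulr_sumr; apply: eq_bigr => f _.
by rewrite tnth_perm_index set_perm_index Ts // mulrCA.
Qed.

End LeviCivita.

(** * Blocks of indices *)

Lemma set_index_same n q (B : q.-tuple 'I_n) k : set_index B k (tnth B k) = B.
Proof.
by apply: eq_from_tnth => j; rewrite tnth_set_index; case: eqP => // ->.
Qed.

Section JoinIndex.
Context {n p : nat} (hp : (2 <= p)%N).
Implicit Types (c d f : 'I_n) (E : (p - 2).-tuple 'I_n).

(** Positions in a p-index split as 2 + (p - 2): [pos0] and [pos1] are the slots of c and d in
    [join_index c d E], and [pos2 k] is that of the k-th entry of E. *)
Definition pos0 : 'I_p := cast_ord (subnKC hp) (lshift (p - 2) ord0).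
Definition pos1 : 'I_p := cast_ord (subnKC hp) (lshift (p - 2) (lift ord0 ord0)).
Definition pos2 (k : 'I_(p - 2)) : 'I_p := cast_ord (subnKC hp) (rshift 2 k).

Lemma pos_ind (P : 'I_p -> Prop) :
  P pos0 -> P pos1 -> (forall k, P (pos2 k)) -> forall k, P k.
Proof.
move=> P0 P1 P2 k; rewrite -(cast_ordKV (subnKC hp) k).
case: (split_ordP (cast_ord (esym (subnKC hp)) k)) => j -> //.
case: (unliftP ord0 j) => [j' ->|->] //.
  by rewrite (ord1 j').
exact: P2.
Qed.

Lemma big_pos (R : nmodType) (F : 'I_p -> R) :
  \sum_k F k = F pos0 + F pos1 + \sum_k F (pos2 k).
Proof.
rewrite (reindex (cast_ord (subnKC hp))) /=; last first.
  apply: onW_bij; exists (cast_ord (esym (subnKC hp))).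
    exact: cast_ordK.
  exact: cast_ordKV.
rewrite big_split_ord /=.
by rewrite big_ord_recl big_ord1.
Qed.

Lemma pos1_pos0 : (pos1 == pos0) = false. Proof. by []. Qed.
Lemma pos0_pos1 : (pos0 == pos1) = false. Proof. by []. Qed.
Lemma pos2_pos0 k : (pos2 k == pos0) = false. Proof. by []. Qed.
Lemma pos0_pos2 k : (pos0 == pos2 k) = false. Proof. by []. Qed.
Lemma pos2_pos1 k : (pos2 k == pos1) = false. Proof. by []. Qed.
Lemma pos1_pos2 k : (pos1 == pos2 k) = false. Proof. by []. Qed.

Lemma pos2_inj : injective pos2.
Proof. by move=> k l /cast_ord_inj/rshift_inj. Qed.

Definition pos_eqE := (pos1_pos0, pos0_pos1, pos2_pos0, pos0_pos2, pos2_pos1,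
  pos1_pos2, inj_eq pos2_inj, eqxx).

Lemma tnth_join0 c d E : tnth (join_index c d E) pos0 = c.
Proof. by rewrite tnth_mktuple. Qed.

Lemma tnth_join1 c d E : tnth (join_index c d E) pos1 = d.
Proof. by rewrite tnth_mktuple. Qed.

Lemma tnth_join2 c d E k : tnth (join_index c d E) (pos2 k) = tnth E k.
Proof. by rewrite tnth_mktuple /= (tnth_nth c). Qed.

Definition tnth_joinE := (tnth_join0, tnth_join1, tnth_join2).

Lemma set_join0 c d E f : set_index (join_index c d E) pos0 f = join_index f d E.
Proof.
apply: eq_from_tnth; apply: pos_ind => [||k];
  by rewrite tnth_set_index !pos_eqE ?tnth_joinE.
Qed.

Lemma set_join1 c d E f : set_index (join_index c d E) pos1 f = join_index c f E.
Proof.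
apply: eq_from_tnth; apply: pos_ind => [||k];
  by rewrite tnth_set_index !pos_eqE ?tnth_joinE.
Qed.

Lemma set_join2 c d E f k :
  set_index (join_index c d E) (pos2 k) f = join_index c d (set_index E k f).
Proof.
apply: eq_from_tnth; apply: pos_ind => [||l];
  by rewrite tnth_set_index !pos_eqE ?tnth_joinE // tnth_set_index.
Qed.

Lemma perm_join01 c d E :
  perm_index (tperm pos0 pos1) (join_index c d E) = join_index d c E.
Proof.
apply: eq_from_tnth; apply: pos_ind => [||l]; rewrite tnth_perm_index.
- by rewrite tpermL !tnth_joinE.
- by rewrite tpermR !tnth_joinE.
- by rewrite tpermD ?pos_eqE // !tnth_joinE.
Qed.

Lemma perm_join02 b d E k f :
  perm_index (tperm pos0 (pos2 k)) (join_index b d (set_index E k f)) =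
  join_index f d (set_index E k b).
Proof.
apply: eq_from_tnth; apply: pos_ind => [||l]; rewrite tnth_perm_index.
- by rewrite tpermL !tnth_joinE tnth_set_index eqxx.
- by rewrite tpermD ?pos_eqE // !tnth_joinE.
- case: (eqVneq l k) => [->|lk].
    by rewrite tpermR !tnth_joinE tnth_set_index eqxx.
  rewrite tpermD ?pos_eqE // 1?eq_sym // !tnth_joinE !tnth_set_index.
  by rewrite (negPf lk).
Qed.

End JoinIndex.

(** * Linearity of the hat convention *)

Section HatSum.
Context {R : realType} {n m : nat} (E : m.-tuple 'I_n).
Implicit Types X Y : 'I_n -> 'I_n -> m.-tuple 'I_n -> R.

Lemma eq_hat_sum X Y : (forall f e F, X f e F = Y f e F) ->
  hat_sum E X = hat_sum E Y.
Proof. by move=> XY; apply: eq_bigr => k _; apply: eq_bigr => f _. Qed.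

Lemma hat_sumD X Y :
  hat_sum E (fun f e F => X f e F + Y f e F) = hat_sum E X + hat_sum E Y.
Proof. by rewrite -big_split; apply: eq_bigr => k _; rewrite -big_split. Qed.

Lemma hat_sumZ (x : R) X :
  hat_sum E (fun f e F => x * X f e F) = x * hat_sum E X.
Proof.
by rewrite mulr_sumr; apply: eq_bigr => k _; rewrite mulr_sumr.
Qed.

Lemma hat_sumN X : hat_sum E (fun f e F => - X f e F) = - hat_sum E X.
Proof. by rewrite -mulN1r -hat_sumZ; apply: eq_hat_sum => *; rewrite mulN1r. Qed.

Lemma hat_sum_alt3 (X : 'I_n -> 'I_n -> 'I_n -> _ -> _ -> _ -> R) a b c :
  hat_sum E (fun f e F => alt3 (fun a b c => X a b c f e F) a b c) =
  alt3 (fun a b c => hat_sum E (X a b c)) a b c.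
Proof. by rewrite hat_sumZ !(hat_sumD, hat_sumN). Qed.

Lemma hat_sum_sym2 (X : 'I_n -> 'I_n -> _ -> _ -> _ -> R) a b :
  hat_sum E (fun f e F => sym2 (fun a b => X a b f e F) a b) =
  sym2 (fun a b => hat_sum E (X a b)) a b.
Proof. by rewrite hat_sumZ hat_sumD. Qed.

Lemma sum_hat_sum (I : finType) (x : I -> R) (X : I -> _ -> _ -> _ -> R) :
  \sum_i x i * hat_sum E (X i) =
  hat_sum E (fun f e F => \sum_i x i * X i f e F).
Proof.
rewrite /hat_sum; under eq_bigr => i _ do rewrite mulr_sumr.
rewrite exchange_big; apply: eq_bigr => k _ /=.
under eq_bigr => i _ do rewrite mulr_sumr.
by rewrite exchange_big.
Qed.

End HatSum.

(** * Killing-Yano tensors in a chart *)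

Section KillingYano.
Context {R : realType} {n : nat} {U : set 'rV[R]_n} (oU : open U).
Context {G : components R n 2} (sG : forall B, smooth_on U (G B)).
Context (symG : forall u, U u ->
  forall a b, G [tuple a; b] u = G [tuple b; a] u).
Context (unitG : forall u, U u -> gram G u \in unitmx).
Context {p : nat} (hp : (2 <= p)%N) {A : components R n p}.
Context (sA : forall B, smooth_on U (A B)).
Context (skewA : forall (s : 'S_p) B u, U u ->
  A (perm_index s B) u = (-1) ^+ odd_perm s * A B u).
Context (kyA : forall a (B : p.-tuple 'I_n) u, U u ->
  nabla G A [tuple of a :: B] u +
  nabla G A [tuple of tnth B (pos0 hp) :: set_index B (pos0 hp) a] u = 0).
Context (u : 'rV[R]_n) (Uu : U u).
Implicit Types (a b c d e f h : 'I_n) (E : (p - 2).-tuple 'I_n).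

Let r := riemann G u.
Let Rl := riemann_low G u.
Let gi := ginv G u.
Let Ric := ricci_up G u.
Let A' c d E := A (join_index c d E) u.

Lemma skewA01 c d E : A' d c E = - A' c d E.
Proof.
rewrite /A' -(perm_join01 hp) skewA // odd_tperm pos0_pos1.
by rewrite expr1 mulN1r.
Qed.

(** A single transposition, of the first slot with the k-th slot of the block: A is skew in its
    first index and the hatted one. *)
Lemma skewA02 b d E k f :
  A' f d (set_index E k b) = - A' b d (set_index E k f).
Proof.
rewrite /A' -(perm_join02 hp) skewA // odd_tperm pos0_pos2.
by rewrite expr1 mulN1r.
Qed.

Lemma skewA12 b d E k f :
  A' d f (set_index E k b) = - A' d b (set_index E k f).
Proof. by rewrite skewA01 skewA02 opprK skewA01. Qed.

(** The skew symmetry of A passes through two covariant derivatives, each fixing its own slot. *)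
Lemma nabla2_skew12 a b c d E :
  nabla G (nabla G A) [tuple of a :: [tuple of b :: join_index d c E]] u =
  - nabla G (nabla G A) [tuple of a :: [tuple of b :: join_index c d E]] u.
Proof.
rewrite -(perm_join01 hp) -perm_index_cons -mulN1r.
apply: (nabla_perm oU (U := U)) => // [C z Uz|C z Uz].
  exact: (nabla_pderivable oU sG unitG sA Uz).
rewrite (tuple_eta C) perm_index_cons.
apply: (nabla_perm oU (U := U)) => // [B y Uy|B y Uy].
  exact: (smooth_on_pderivable (sA B) Uy).
by rewrite skewA // odd_tperm pos0_pos1 expr1.
Qed.

(** The Killing-Yano equation says that nabla A changes sign when the derivative index is exchanged
    with the first index of A. As a symmetry of a tensor of rank p + 1 it survives one more
    derivative. *)
Lemma nabla2_skew01 a b c d E :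
  nabla G (nabla G A) [tuple of a :: [tuple of c :: join_index b d E]] u =
  - nabla G (nabla G A) [tuple of a :: [tuple of b :: join_index c d E]] u.
Proof.
have swap x (B : p.-tuple 'I_n) :
    perm_index (tperm ord0 (lift ord0 (pos0 hp))) [tuple of x :: B] =
    [tuple of tnth B (pos0 hp) :: set_index B (pos0 hp) x].
  apply: eq_from_tnth => j; rewrite tnth_perm_index.
  case: (unliftP ord0 j) => [k ->|->]; last by rewrite tpermL tnthS.
  rewrite tnthS tnth_set_index; case: (eqVneq k (pos0 hp)) => [->|k0].
    by rewrite tpermR.
  by rewrite tpermD ?tnthS // (inj_eq lift_inj) eq_sym.
have := swap b (join_index c d E).
rewrite tnth_join0 set_join0 => <-; rewrite -mulN1r.
apply: (nabla_perm oU (U := U)) => // [C z Uz|C z Uz].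
  exact: (nabla_pderivable oU sG unitG sA Uz).
rewrite (tuple_eta C) swap mulN1r; apply/eqP; rewrite -addr_eq0 addrC.
by rewrite kyA.
Qed.

(** By the Ricci identity this is the commutator of nabla_a and nabla_b on A_{cdE}. *)
Let S a b c d E := \sum_k \sum_f
  r a b (tnth (join_index c d E) k) f * A (set_index (join_index c d E) k f) u.

Lemma riemann_actionE a b c d E : S a b c d E =
  \sum_f r a b c f * A' f d E + \sum_f r a b d f * A' c f E
  + hat_sum E (fun f e F => r a b e f * A' c d F).
Proof.
rewrite /S (big_pos hp) /hat_sum /A'; congr (_ + _ + _).
- by apply: eq_bigr => f _; rewrite set_join0 tnth_join0.
- by apply: eq_bigr => f _; rewrite set_join1 tnth_join1.
- apply: eq_bigr => k _; apply: eq_bigr => f _.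
  by rewrite set_join2 tnth_join2.
Qed.

Lemma killing_yano_integrability a b c d E :
  [/\ S a b c d E + S c d a b E = S b c a d E + S a d b c E,
      S a b c d E + S c d a b E = - (S a c b d E + S b d a c E) &
      S a b d c E = - S a b c d E].
Proof.
pose x a b c d :=
  nabla G (nabla G A) [tuple of a :: [tuple of b :: join_index c d E]] u.
have SE a' b' c' d' : S a' b' c' d' E = x a' b' c' d' - x b' a' c' d'.
  by rewrite /S -(nabla_commutator oU sG symG unitG _ _ _ sA Uu).
have x1 a' b' c' d' : x a' b' d' c' = - x a' b' c' d'.
  exact: nabla2_skew12.
have x0 a' b' c' d' : x a' c' b' d' = - x a' b' c' d'.
  exact: nabla2_skew01.
have x2 a' b' c' d' : x a' d' b' c' = x a' b' c' d'.
  by rewrite x0 x1 opprK.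
(* Sorting the last three indices up to sign leaves four components, one for each choice of the
   outer derivative index. *)
rewrite !SE (x2 c a b d) (x2 d a b c) (x0 b a c d) (x0 c a b d) (x2 a b c d).
rewrite (x0 a b c d) (x2 b a c d) (x0 d a b c) (x1 a b c d) (x1 b a c d).
move: (x a b c d) (x b a c d) (x c a b d) (x d a b c) => y1 y2 y3 y4.
by split; ring.
Qed.

(** * The uncontracted identity *)

Lemma riemann_raise a b c f : \sum_h gi f h * Rl a b c h = r a b c f.
Proof.
rewrite /Rl /riemann_low -/r.
under eq_bigr => h _ do rewrite mulr_sumr.
rewrite exchange_big /= (bigD1 f) //= [X in _ + X]big1 => [|k kf].
  under eq_bigr => h _ do rewrite mulrCA (symG Uu f).
  by rewrite -mulr_sumr (ginvK unitG) // eqxx mulr1 addr0.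
under eq_bigr => h _ do rewrite mulrCA (symG Uu k).
by rewrite -mulr_sumr (ginvK unitG) // eq_sym (negPf kf) mulr0.
Qed.

Let Rl_pair a b c d : Rl c d a b = Rl a b c d.
Proof. exact: (riemann_low_pair_sym oU sG symG unitG). Qed.

Let Rl_skew_r a b c d : Rl a b d c = - Rl a b c d.
Proof. exact: (riemann_low_antisym_r oU sG symG unitG). Qed.

Let Rl_skew_l a b c d : Rl b a c d = - Rl a b c d.
Proof. exact: riemann_low_antisym_l. Qed.

Let r_skew a b c f : r b a c f = - r a b c f.
Proof. exact: riemann_antisym. Qed.

(** Pair symmetry moves the raised index into the second pair, and skewness puts it last, at the
    cost of the sign. *)
Lemma riemann_upE f a b c : riemann_up G u f a b c = - r b c a f.
Proof.
rewrite -riemann_raise -sumrN; apply: eq_bigr => h _.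
by rewrite -/gi -/Rl -Rl_pair Rl_skew_r mulrN.
Qed.

Lemma riemann_killing_yano a b c d E :
  let Rm := riemann_up G u in
  0 = \sum_f Rm f a c b * A' d f E + \sum_f Rm f b d a * A' c f E
      + \sum_f Rm f c a d * A' b f E + \sum_f Rm f d b c * A' a f E
      + hat_sum E (fun f e F =>
          alt3 (fun b c d => Rm f e b c * A' d a F) b c d)
      + 2 * hat_sum E (fun f e F =>
          alt3 (fun b c d => Rm f e a b * A' c d F) b c d)
      + 2 * hat_sum E (fun f e F => Rm f e b c * A' a d F)
      - 3 * hat_sum E (fun f e F =>
          alt3 (fun a b c => Rm f e a b * A' c d F) a b c).
Proof.
move=> Rm.
(* [L] carries the action of the curvature on the first two slots of A, [H] that on the block; every
   term of the identity is, up to sign, one of these. *)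
pose L a b c d := \sum_f r a b c f * A' d f E.
pose H a b c d := hat_sum E (fun f e F => r a b e f * A' c d F).
have SE a' b' c' d' :
    S a' b' c' d' E = L a' b' d' c' - L a' b' c' d' + H a' b' c' d'.
  rewrite riemann_actionE [L _ _ _ _ - _]addrC; congr (_ + _ + _).
  by rewrite -sumrN; apply: eq_bigr => f _; rewrite skewA01 mulrN.
have L_skew a' b' c' d' : L b' a' c' d' = - L a' b' c' d'.
  by rewrite -sumrN; apply: eq_bigr => f _; rewrite r_skew mulNr.
have L_cyc a' b' c' d' : L a' b' c' d' + L b' c' a' d' + L c' a' b' d' = 0.
  rewrite -!big_split big1 //= => f _; rewrite -!mulrDl.
  by rewrite (riemann_cyclic oU sG symG unitG) // mul0r.
have H_skew_l a' b' c' d' : H b' a' c' d' = - H a' b' c' d'.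
  by rewrite -hat_sumN; apply: eq_hat_sum => *; rewrite r_skew mulNr.
have H_skew_r a' b' c' d' : H a' b' d' c' = - H a' b' c' d'.
  by rewrite -hat_sumN; apply: eq_hat_sum => *; rewrite skewA01 mulrN.
have LE a' b' c' d' : \sum_f Rm f a' b' c' * A' d' f E = - L b' c' a' d'.
  by rewrite -sumrN; apply: eq_bigr => f _; rewrite /Rm riemann_upE mulNr.
have HE a' b' c' d' :
    hat_sum E (fun f e F => Rm f e a' b' * A' c' d' F) = - H a' b' c' d'.
  by rewrite -hat_sumN; apply: eq_hat_sum => *; rewrite /Rm riemann_upE mulNr.
rewrite (hat_sum_alt3 E (fun b c d f e F => Rm f e b c * A' d a F)).
rewrite (hat_sum_alt3 E (fun b c d f e F => Rm f e a b * A' c d F)).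
rewrite (hat_sum_alt3 E (fun a b c f e F => Rm f e a b * A' c d F)).
rewrite /alt3 !HE !LE.
have [I1 I2 _] := killing_yano_integrability a b c d E.
rewrite !SE in I1 I2; clearbody L H.
(* One Bianchi identity for each index left on A. Modulo skew symmetry there remain twelve values of
   [L] and six of [H], and the claim is a linear consequence. *)
move: I1 I2; move: (L_cyc a b c d) (L_cyc a b d c) (L_cyc a c d b)
  (L_cyc b c d a).
rewrite ?(L_skew a b) ?(L_skew a c) ?(L_skew a d) ?(L_skew b c) ?(L_skew b d).
rewrite ?(L_skew c d).
rewrite ?(H_skew_l a b) ?(H_skew_l a c) ?(H_skew_l a d) ?(H_skew_l b c)
  ?(H_skew_l b d) ?(H_skew_l c d).
rewrite ?(H_skew_r _ _ a b) ?(H_skew_r _ _ a c) ?(H_skew_r _ _ a d)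
  ?(H_skew_r _ _ b c) ?(H_skew_r _ _ b d) ?(H_skew_r _ _ c d).
move: (L a b c d) (L b c a d) (L a c b d) (L a b d c) (L b d a c) (L a d b c)
  (L a c d b) (L c d a b) (L a d c b) (L b c d a) (L c d b a) (L b d c a)
  (H a b c d) (H c d a b) (H b c a d) (H a d b c) (H a c b d) (H b d a c).
move=> l1 l2 l3 l4 l5 l6 l7 l8 l9 l10 l11 l12 h1 h2 h3 h4 h5 h6.
lra.
Qed.

(** * The contracted identity *)

Let P c e b f := \sum_a gi a b * r a c e f.

(** [RR] is R^{bf}_{ec}, with the first pair raised, whereas [P] is R^b_{ce}^f, with the two outer
    indices raised. *)
Let RR b f e c := \sum_a \sum_h gi b a * gi f h * Rl a h e c.

Let gi_sym a b : gi a b = gi b a.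
Proof. exact: (ginv_sym symG). Qed.

Lemma riemann_half_raise c e b f :
  P c e b f = \sum_a \sum_h gi b a * gi f h * Rl a c e h.
Proof.
apply: eq_bigr => a _; rewrite -riemann_raise mulr_sumr.
by apply: eq_bigr => h _; rewrite mulrA gi_sym.
Qed.

(** Reversing the order of the four indices is a symmetry of the Riemann tensor. *)
Lemma riemann_half_raise_sym c d b f : P c d b f = P d c f b.
Proof.
rewrite !riemann_half_raise exchange_big; apply: eq_bigr => h _.
apply: eq_bigr => a _ /=; rewrite [gi b a * _]mulrC; congr (_ * _).
by rewrite -Rl_pair Rl_skew_l Rl_skew_r opprK.
Qed.

(** The Bianchi identity in the form R_{aceh} - R_{hcea} = R_{ahec}, with a and h raised. *)
Lemma riemann_half_raise_alt c e b f : P c e b f - P c e f b = RR b f e c.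
Proof.
rewrite !riemann_half_raise [X in _ - X]exchange_big -sumrB.
apply: eq_bigr => a _; rewrite -sumrB; apply: eq_bigr => h _ /=.
rewrite [gi f h * _]mulrC -mulrBr; congr (_ * _).
have := riemann_low_cyclic oU sG symG unitG a c e h Uu.
have E1 : Rl c e a h = - Rl a h e c by rewrite -(Rl_skew_r a h e c) Rl_pair.
have E2 : Rl e a c h = - Rl h c e a by rewrite -(Rl_skew_l h c e a) Rl_pair.
rewrite -/Rl E1 E2 => /eqP; rewrite -addrA addrC -opprD addrC subr_eq0.
by move/eqP => ->; rewrite addrK.
Qed.

Lemma ricci_trace f c : \sum_a \sum_b gi a b * r a c b f = Ric f c.
Proof.
apply: eq_bigr => a _; apply: eq_bigr => b _.
rewrite -riemann_raise mulr_sumr; apply: eq_bigr => h _.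
by rewrite mulrA -Rl_pair.
Qed.

(** The trace [K] of the curvature action has a Ricci part [N] from the first slot, a part [Q] from
    the second and a part [V] from the block. Symmetrized in c and d, [K] vanishes by integrability
    and [Q] by skewness of A. *)
Lemma contracted_integrability c d E :
  \sum_f Ric f c * A' d f E + \sum_f Ric f d * A' c f E
  + 2^-1 * (hat_sum E (fun f e F => \sum_a RR a f e c * A' d a F)
          + hat_sum E (fun f e F => \sum_a RR a f e d * A' c a F)) = 0.
Proof.
pose N c d := \sum_f Ric f c * A' d f E.
pose V c d := hat_sum E (fun f e F => \sum_a RR a f e c * A' d a F).
pose Q c d := \sum_b \sum_f P c d b f * A' b f E.
pose K c d := \sum_a \sum_b gi a b * S a c b d E.
have QE : Q c d + Q d c = 0.
  rewrite /Q [X in _ + X]exchange_big -big_split big1 //= => b _.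
  rewrite -big_split big1 //= => f _.
  by rewrite riemann_half_raise_sym skewA01 mulrN addNr.
(* A is skew in the summed indices b and f, so only the skew part of [P] in them contributes; by
   Bianchi it is half of [RR]. *)
have VE c' d' : hat_sum E (fun f e F => \sum_b P c' e b f * A' b d' F) =
    - (2^-1 * V c' d').
  rewrite /V -hat_sumZ -hat_sumN; apply: eq_bigr => k _.
  set e := tnth E k.
  pose Z b f := A' b d' (set_index E k f).
  have ZE b f : Z f b = - Z b f by exact: skewA02.
  transitivity (\sum_f \sum_b P c' e b f * Z b f); first by [].
  have E1 : \sum_f \sum_b P c' e b f * Z b f =
      - \sum_f \sum_b P c' e f b * Z b f.
    rewrite exchange_big -sumrN; apply: eq_bigr => b _.
    by rewrite -sumrN; apply: eq_bigr => f _; rewrite ZE mulrN.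
  have E2 : \sum_f (- (2^-1 * \sum_a RR a f e c' * A' d' a (set_index E k f))) =
     2^-1 * (\sum_f \sum_b P c' e b f * Z b f - \sum_f \sum_b P c' e f b * Z b f).
    rewrite -sumrB mulr_sumr; apply: eq_bigr => f _.
    rewrite -mulrN; congr (_ * _); rewrite -sumrB -sumrN.
    apply: eq_bigr => b _; rewrite -riemann_half_raise_alt skewA01.
    by rewrite mulrN opprK mulrBl.
  by rewrite E2 E1; move: (\sum_f \sum_b _) => y; lra.
have NE c' d' : \sum_a \sum_b gi a b * \sum_f r a c' b f * A' f d' E =
    - N c' d'.
  transitivity (\sum_f Ric f c' * A' f d' E); last first.
    by rewrite -sumrN; apply: eq_bigr => f _; rewrite skewA01 mulrN.
  under [RHS]eq_bigr => f _ do rewrite -ricci_trace mulr_suml.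
  rewrite [RHS]exchange_big; apply: eq_bigr => a _ /=.
  under [RHS]eq_bigr => f _ do rewrite mulr_suml.
  rewrite [RHS]exchange_big; apply: eq_bigr => b _ /=.
  by rewrite mulr_sumr; apply: eq_bigr => f _; rewrite mulrA.
have KE c' d' : K c' d' = - N c' d' + Q c' d' - 2^-1 * V c' d'.
  rewrite /K; under eq_bigr => a _ do
    under eq_bigr => b _ do rewrite riemann_actionE !mulrDr.
  under eq_bigr => a _ do rewrite !big_split.
  rewrite !big_split /= NE -VE; congr (_ + _ + _).
    rewrite exchange_big; apply: eq_bigr => b _ /=.
    under eq_bigr => a _ do rewrite mulr_sumr.
    rewrite exchange_big; apply: eq_bigr => f _ /=.
    by rewrite mulr_suml; apply: eq_bigr => a _; rewrite mulrA.
  rewrite exchange_big /=.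
  under eq_bigr => b _ do rewrite sum_hat_sum.
  rewrite /hat_sum exchange_big; apply: eq_bigr => k _ /=.
  rewrite exchange_big; apply: eq_bigr => f _ /=; apply: eq_bigr => b _.
  by rewrite mulr_suml; apply: eq_bigr => a _; rewrite mulrA.
have KK : K c d + K d c = 0.
  have S_skew_l a b : S b a c d E = - S a b c d E.
    rewrite -sumrN; apply: eq_bigr => k _; rewrite -sumrN.
    by apply: eq_bigr => f _; rewrite r_skew mulNr.
  have S_skew_r a b : S c d b a E = - S c d a b E.
    by have [_ _] := killing_yano_integrability c d a b E.
  (* [T] is skew in a and b, so its trace with the symmetric inverse metric is zero. *)
  pose T a b := S a b c d E + S c d a b E.
  have T0 : \sum_a \sum_b gi a b * T a b = - \sum_a \sum_b gi a b * T a b.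
    rewrite {1}exchange_big -sumrN; apply: eq_bigr => a _.
    rewrite -sumrN; apply: eq_bigr => b _ /=.
    by rewrite gi_sym /T S_skew_l S_skew_r -opprD mulrN.
  have -> : K c d + K d c = - \sum_a \sum_b gi a b * T a b.
    rewrite /K [X in _ + X]exchange_big -big_split -sumrN.
    apply: eq_bigr => a _; rewrite -big_split -sumrN.
    apply: eq_bigr => b _ /=; rewrite (gi_sym b a) -mulrDr -mulrN.
    by have [_ I _] := killing_yano_integrability a b c d E; rewrite /T I opprK.
  by move: T0; move: (\sum_a \sum_b _) => y; lra.
move: KK; rewrite !KE -/(N c d) -/(N d c) -/(V c d) -/(V d c).
move: QE; move: (N c d) (N d c) (V c d) (V d c) (Q c d) (Q d c).
move=> x1 x2 x3 x4 x5 x6; lra.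
Qed.

(** * Passing from the Riemann to the Weyl tensor *)

Lemma ricci_raise a b : \sum_h gi a h * ricci_low G u h b = Ric a b.
Proof.
rewrite /ricci_low -/Ric.
under eq_bigr => h _ do rewrite mulr_sumr.
rewrite exchange_big /= (bigD1 a) //= [X in _ + X]big1 => [|k ka].
  under eq_bigr => h _ do rewrite mulrA.
  by rewrite -mulr_suml (ginvK unitG) // eqxx mul1r addr0.
under eq_bigr => h _ do rewrite mulrA.
by rewrite -mulr_suml (ginvK unitG) // eq_sym (negPf ka) mul0r.
Qed.

Let raise2 a f (x y : 'I_n -> R) :
  \sum_h \sum_k gi a h * gi f k * (x h * y k) =
  (\sum_h gi a h * x h) * (\sum_k gi f k * y k).
Proof.
rewrite mulr_suml; apply: eq_bigr => h _; rewrite mulr_sumr.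
by apply: eq_bigr => k _; rewrite mulrACA.
Qed.

(** Raising turns each metric factor into a Kronecker delta and each lowered Ricci factor into the
    mixed Ricci tensor. *)
Lemma weyl_upE a f e c : n != 2 ->
  weyl_up G u a f e c = RR a f e c
  - (n%:R - 2)^-1 * ((a == e)%:R * Ric f c - (a == c)%:R * Ric f e
                     - (f == e)%:R * Ric a c + (f == c)%:R * Ric a e)
  + scalar_curvature G u / ((n%:R - 1) * (n%:R - 2))
    * ((a == e)%:R * (f == c)%:R - (a == c)%:R * (f == e)%:R).
Proof.
move=> /negPf n2; rewrite /weyl_up /weyl_low n2.
set ka := (n%:R - 2)^-1; set si := _ / _.
pose g a b := G [tuple a; b] u; pose Rc := ricci_low G u.
transitivity (\sum_h \sum_k (gi a h * gi f k * Rl h k e c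
  - ka * (gi a h * gi f k * (g h e * Rc k c)
    - gi a h * gi f k * (g h c * Rc k e)
    - gi a h * gi f k * (Rc h c * g k e)
    + gi a h * gi f k * (Rc h e * g k c))
  + si * (gi a h * gi f k * (g h e * g k c)
    - gi a h * gi f k * (g h c * g k e)))).
  apply: eq_bigr => h _; apply: eq_bigr => k _.
  rewrite -/gi -/Rl -/Rc -/(g h e) -/(g k c) -/(g h c) -/(g k e).
  move: (gi a h) (gi f k) (Rl h k e c) ka si (g h e) (g k c) (g h c) (g k e)
    (Rc k c) (Rc k e) (Rc h c) (Rc h e).
  by move=> *; ring.
under eq_bigr => h _ do
  rewrite big_split sumrB -!mulr_sumr sumrB big_split !sumrB /=.
rewrite big_split sumrB -!mulr_sumr sumrB big_split !sumrB /= !raise2.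
by rewrite !ricci_raise !(ginvK unitG) // ![Ric a _ * _]mulrC.
Qed.

(** The deltas collapse each correction term to one sum. The last two terms of the result are skew
    in c and d and are meant to disappear under symmetrization. *)
Lemma weyl_killing_yano c d E : n != 2 ->
  (n%:R - 2) * hat_sum E (fun f e F => \sum_a weyl_up G u a f e c * A' d a F) =
  (n%:R - 2) * hat_sum E (fun f e F => \sum_a RR a f e c * A' d a F)
  + 2 * (p%:R - 2) * \sum_f Ric f c * A' d f E
  + 2 * \sum_k \sum_f Ric f (tnth E k) * A' d c (set_index E k f)
  - 2 * (p%:R - 2) * (n%:R - 2)
    * (scalar_curvature G u / ((n%:R - 1) * (n%:R - 2))) * A' d c E.
Proof.
move=> n2; have n2' : n%:R - 2 != 0 :> R by rewrite subr_eq0 eqr_nat.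
set si := _ / _.
(* [h1] to [h4] come from the four Ricci terms of [weyl_upE], [h5] and [h6] from the scalar
   curvature. *)
pose h1 := hat_sum E (fun f e F => \sum_a (a == e)%:R * Ric f c * A' d a F).
pose h2 := hat_sum E (fun f e F => \sum_a (a == c)%:R * Ric f e * A' d a F).
pose h3 := hat_sum E (fun f e F => \sum_a (f == e)%:R * Ric a c * A' d a F).
pose h4 := hat_sum E (fun f e F => \sum_a (f == c)%:R * Ric a e * A' d a F).
pose h5 := hat_sum E
  (fun f e F => \sum_a (a == e)%:R * (f == c)%:R * A' d a F).
pose h6 := hat_sum E
  (fun f e F => \sum_a (a == c)%:R * (f == e)%:R * A' d a F).
have -> : hat_sum E (fun f e F => \sum_a weyl_up G u a f e c * A' d a F) =
    hat_sum E (fun f e F => \sum_a RR a f e c * A' d a F)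
    - (n%:R - 2)^-1 * (h1 - h2 - h3 + h4) + si * (h5 - h6).
  rewrite /h1 /h2 /h3 /h4 /h5 /h6 -!hat_sumN -!hat_sumD -!hat_sumZ -hat_sumN.
  rewrite -!hat_sumD; apply: eq_hat_sum => f e F.
  rewrite -!sumrN -!big_split !mulr_sumr -sumrN -!big_split /=.
  apply: eq_bigr => a _; rewrite weyl_upE // -/si.
  move: (RR a f e c) (n%:R - 2)^-1 si (Ric f c) (Ric f e) (Ric a c) (Ric a e)
    (A' d a F) => *; ring.
have delta_l (x : 'I_n) (Y : 'I_n -> R) : \sum_a (a == x)%:R * Y a = Y x.
  rewrite (bigD1 x) //= eqxx mul1r big1 ?addr0 // => a /negPf ->.
  by rewrite mul0r.
have skew2 k f : A' d (tnth E k) (set_index E k f) = - A' d f E.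
  by rewrite skewA12 set_index_same.
(* Each of the p - 2 positions of the block contributes equally; 2 <= p makes the natural and the
   real difference agree. *)
have size_E (x : R) : \sum_(k < p - 2) x = (p%:R - 2) * x.
  by rewrite sumr_const card_ord -(natrB _ hp) mulr_natl.
have h1E : h1 = - ((p%:R - 2) * \sum_f Ric f c * A' d f E).
  rewrite -size_E -sumrN; apply: eq_bigr => k _; rewrite -sumrN.
  apply: eq_bigr => f _.
  under eq_bigr => a _ do rewrite -mulrA.
  by rewrite delta_l skew2 mulrN.
have h2E : h2 = \sum_k \sum_f Ric f (tnth E k) * A' d c (set_index E k f).
  apply: eq_bigr => k _; apply: eq_bigr => f _.
  under eq_bigr => a _ do rewrite -mulrA.
  by rewrite delta_l.
have h3E : h3 = (p%:R - 2) * \sum_f Ric f c * A' d f E.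
  rewrite -size_E; apply: eq_bigr => k _; rewrite exchange_big /=.
  apply: eq_bigr => a _.
  under eq_bigr => f _ do rewrite -mulrA.
  rewrite delta_l; congr (_ * A' _ _ _).
  exact: set_index_same.
have h4E : h4 = - h2.
  rewrite h2E -sumrN; apply: eq_bigr => k _; rewrite exchange_big -sumrN /=.
  apply: eq_bigr => a _.
  under eq_bigr => f _ do rewrite -mulrA.
  by rewrite delta_l -mulrN -skewA12.
have h5E : h5 = - ((p%:R - 2) * A' d c E).
  rewrite -size_E -sumrN; apply: eq_bigr => k _.
  under eq_bigr => f _.
    under eq_bigr => a _ do rewrite -mulrA.
    rewrite delta_l; over.
  by rewrite delta_l skew2.
have h6E : h6 = (p%:R - 2) * A' d c E.
  rewrite -size_E; apply: eq_bigr => k _.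
  under eq_bigr => f _.
    under eq_bigr => a _ do rewrite -mulrA.
    rewrite delta_l; over.
  by rewrite delta_l set_index_same.
rewrite h1E h3E h4E h5E h6E -h2E.
clear h1E h2E h3E h4E h5E h6E; clearbody h2.
move: (hat_sum _ _) (\sum_f _) h2 (p%:R - 2) (A' d c E) si (n%:R - 2) n2'.
move=> y1 y2 y3 y4 y5 y6 y7 y70; field; exact: y70.
Qed.

(** By the pigeonhole principle some index is repeated; transposing its two positions gives A = -
    A. *)
Lemma skewA_eq0 B : (n < p)%N -> A B u = 0.
Proof.
move=> np; have /injectivePn[i [j ij Bij]] : ~~ injectiveb (tnth B).
  by apply: contraL np => /injectiveP/leq_card; rewrite !card_ord -leqNgt.
have := skewA (tperm i j) B Uu; rewrite odd_tperm ij expr1 mulN1r.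
have -> : perm_index (tperm i j) B = B.
  by apply: eq_from_tnth => k; rewrite tnth_perm_index; case: tpermP => // ->.
by move: (A B u) => y; lra.
Qed.

(** Eliminating the Riemann term with [contracted_integrability] leaves the Ricci term with
    coefficient 2(p - 2) - 2(n - 2) = - 2(n - p). *)
Lemma ricci_weyl_killing_yano c d E : (2 <= n)%N ->
  0 = 2 * (n%:R - p%:R) * sym2 (fun c d => \sum_f Ric f c * A' d f E) c d
      + (n%:R - 2) * hat_sum E (fun f e F =>
          sym2 (fun c d => \sum_a weyl_up G u a f e c * A' d a F) c d).
Proof.
move=> hn.
rewrite (hat_sum_sym2 E
  (fun c d f e F => \sum_a weyl_up G u a f e c * A' d a F)) /sym2.
(* For n = 2 the Weyl term has coefficient zero; the Ricci term vanishes through n - p if p = 2 and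
   through A otherwise. *)
case: (eqVneq n 2) => [n2|n2].
  have n2R : n%:R = 2 :> R by exact: (congr1 (fun m => m%:R) n2).
  rewrite n2R subrr mul0r addr0.
  move: (hp); rewrite leq_eqVlt => /orP[/eqP p2|p2].
    have p2R : p%:R = 2 :> R by exact: (congr1 (fun m => m%:R) (esym p2)).
    by rewrite p2R subrr mulr0 mul0r.
  have Y0 c' d' : \sum_f Ric f c' * A' d' f E = 0.
    by rewrite big1 // => f _; rewrite /A' skewA_eq0 ?mulr0 // n2.
  by rewrite !Y0 addr0 !mulr0.
have := contracted_integrability c d E.
have := weyl_killing_yano c d E n2; have := weyl_killing_yano d c E n2.
have -> : \sum_k \sum_f Ric f (tnth E k) * A' d c (set_index E k f) =
    - \sum_k \sum_f Ric f (tnth E k) * A' c d (set_index E k f).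
  rewrite -sumrN; apply: eq_bigr => k _; rewrite -sumrN.
  by apply: eq_bigr => f _; rewrite skewA01 mulrN.
rewrite (skewA01 c d).
move: (n%:R : R) (p%:R : R)
  (hat_sum E _) (hat_sum E _) (hat_sum E _) (hat_sum E _)
  (\sum_f Ric f d * A' c f E) (\sum_f Ric f c * A' d f E)
  (\sum_k \sum_f _) (A' c d E) (_ / _).
move=> m q vr vc wr wc nd nc y a s Wd Wc K.
have -> : (m - 2) * (2^-1 * (vc + wc)) =
    2^-1 * ((m - 2) * vc + (m - 2) * wc) by ring.
have vrE : vr = - 2 * (nc + nd) - wr by lra.
by rewrite Wc Wd vrE; field.
Qed.

End KillingYano.

(** * Transfer to the manifold *)

Theorem mainTheorem2 (R : realType) (n p : nat) (hn : (2 <= n)%N)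
    (hp : (2 <= p)%N) (M : manifold R n) (g : tensor_field M 2)
    (A : tensor_field M p) (hg : pseudo_riemannian g)
    (hA : killing_yano g A) (i : chart M) (x : M) (hx : chart_dom i x) :
  let u := chart_map i x in
  let Rm := riemann_up (g i) u in
  let Ric := ricci_up (g i) u in
  let C := weyl_up (g i) u in
  let A' c d (E : (p - 2).-tuple 'I_n) := A i (join_index c d E) u in
  (forall (a b c d : 'I_n) (E : (p - 2).-tuple 'I_n),
    0 = \sum_f Rm f a c b * A' d f E + \sum_f Rm f b d a * A' c f E
        + \sum_f Rm f c a d * A' b f E + \sum_f Rm f d b c * A' a f E
        + hat_sum E (fun f e F =>
            alt3 (fun b c d => Rm f e b c * A' d a F) b c d)
        + 2 * hat_sum E (fun f e F =>
            alt3 (fun b c d => Rm f e a b * A' c d F) b c d)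
        + 2 * hat_sum E (fun f e F => Rm f e b c * A' a d F)
        - 3 * hat_sum E (fun f e F =>
            alt3 (fun a b c => Rm f e a b * A' c d F) a b c)) /\
  (forall (c d : 'I_n) (E : (p - 2).-tuple 'I_n),
    0 = 2 * (n%:R - p%:R) * sym2 (fun c d => \sum_f Ric f c * A' d f E) c d
        + (n%:R - 2) * hat_sum E (fun f e F =>
            sym2 (fun c d => \sum_a C a f e c * A' d a F) c d)).
Proof.
move=> u Rm Ric C A'.
(* The hypotheses at points of the chart domain become statements on its open coordinate image [U],
   where they can be differentiated. *)
pose U : set 'rV[R]_n := (chart_map i @` chart_dom i)%classic.
have oU : open U by exact: chart_img_open.
have sG B : smooth_on U (g i B) by exact: comp_smooth.
have sA B : smooth_on U (A i B) by exact: comp_smooth.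
have symG z : U z -> forall a b, g i [tuple a; b] z = g i [tuple b; a] z.
  by move=> [y hy <-]; exact: (hg _ _ hy).1.
have unitG z : U z -> gram (g i) z \in unitmx.
  by move=> [y hy <-]; exact: (hg _ _ hy).2.
have [skA kyA] := hA.
have skewA (s : 'S_p) B z : U z ->
    A i (perm_index s B) z = (-1) ^+ odd_perm s * A i B z.
  by move=> [y hy <-]; exact: skA.
(* The position of b_1 is taken to be [pos0 hp], whose value computes to 0. *)
have kyA' a (B : p.-tuple 'I_n) z : U z ->
    nabla (g i) (A i) [tuple of a :: B] z +
    nabla (g i) (A i)
      [tuple of tnth B (pos0 hp) :: set_index B (pos0 hp) a] z = 0.
  by move=> [y hy <-]; exact: kyA.
have Uu : U u by exists x.
split=> [a b c d E|c d E].
  exact: (riemann_killing_yano oU sG symG unitG sA skewA kyA' Uu).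
exact: (ricci_weyl_killing_yano oU sG symG unitG sA skewA kyA' Uu).
Qed.
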